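(* For any fixed number of variables $n$, the probability $p_d$ tends to $1$ as $d\to+\infty$.
   Context: $\mathbb{K}$ is an algebraically closed field of characteristic zero, and $S=\mathbb{K}[x_1,\ldots,x_n]$ is the polynomial ring in $n$ variables. $S_m$ denotes the $m$-th graded component of $S$, i.e. the linear space of all homogeneous polynomials of degree $m$ in $n$ variables. For a positive integer $d$, define $$p_d=\frac{\#\{z\leq \dim(S_d) : z \text{ is covered}\}}{\dim(S_d)},$$ the ''probability'' that a given $z\leq\dim(S_d)$ is covered, where a positive integer $z$ is called covered (for the given $d$) if there exists an integer $r\geq 0$ such that $$\frac{\dim(S_{d+r+1})}{\dim(S_{r+1})}+\dim(S_{r+1}) \leq z \leq \frac{\dim(S_{d+r})}{\dim(S_r)}-\dim(S_r).$$
   Formalization: The number of variables n is assumed to be at least 2: for n = 1 every dim(S_m) is 1, no z is covered and p_d = 0 for all d, and for n = 0 the quotient p_d is undefined for d > 0. *)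

(* Defs.v *)
From mathcomp Require Import all_boot all_order all_algebra.
From mathcomp Require Import all_classical all_reals all_analysis.
(* Only the canonical instances of mpoly are imported: its notations clash with
   those of MathComp-Analysis. *)
From mathcomp Require mpoly.
Import (canonicals) mpoly.

Set Implicit Arguments.
Unset Strict Implicit.
Unset Printing Implicit Defensive.

Import Order.TTheory GRing.Theory Num.Theory.
Import numFieldNormedType.Exports.

Local Open Scope ring_scope.

(* dim(S_m) for S = K[x_1, ..., x_n]. The type [mpoly.dhomog n K m] of
   homogeneous polynomials of degree m in n variables is a finite-dimensional
   vector space in the library only when n is a successor; for n = 0, S = K is
   concentrated in degree 0. *)
Definition dimS (K : fieldType) (n m : nat) : nat :=
  if n is n'.+1 then \dim {: mpoly.dhomog n'.+1 K m} else (m == 0)%N.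

(* The quotients of dimensions are exact rational numbers. *)
Definition covered (K : fieldType) (n d z : nat) : Prop :=
  exists r : nat,
    (dimS K n (d + r + 1))%:R / (dimS K n (r + 1))%:R + (dimS K n (r + 1))%:R
      <= z%:R :> rat
    /\ z%:R <= (dimS K n (d + r))%:R / (dimS K n r)%:R - (dimS K n r)%:R :> rat.

Definition p (R : realType) (K : fieldType) (n d : nat) : R :=
  #|[pred z : 'I_(dimS K n d).+1 | (0 < z)%N && `[< covered K n d z >]]|%:R
  / (dimS K n d)%:R.

(* Main.v *)
Require Import Defs.
From mathcomp Require Import all_boot all_order all_algebra.
From mathcomp Require Import all_classical all_reals all_analysis.
From mathcomp Require Import zify.

Import Order.TTheory GRing.Theory Num.Theory.
Import numFieldNormedType.Exports.

Local Open Scope classical_set_scope.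
Local Open Scope ring_scope.

(** Write [D r] for [dim S_r] and [q r] for the integer part of
    [D (d + r) / D r]. An uncovered [z] that lies below the upper end of the
    [r]-th interval must lie below the lower end of the same interval, hence
    either in the gap of length about [2 D (r + 1)] around [q (r + 1)] or below
    the upper end of the next interval. Hence for each fixed [m] all uncovered
    [z] lie in [m] gaps of total size bounded independently of [d], or below
    [q m + D m]. For large [d], [D (d + m) <= 2 D d], so [q m / D d] is at most
    [2 / D m <= 2 / (m + 1)]. *)

Lemma dimS_bin (K : fieldType) n d : dimS K n.+1 d = 'C(d + n, d).
Proof. by rewrite /dimS dimvf. Qed.

Lemma dimS_deg0 (K : fieldType) n : dimS K n.+1 0 = 1%N.
Proof. by rewrite dimS_bin bin0. Qed.

Lemma dimS_gt0 (K : fieldType) n d : (0 < dimS K n.+1 d)%N.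
Proof. by rewrite dimS_bin bin_gt0 leq_addr. Qed.

Lemma dimS_recr (K : fieldType) n d :
  (d.+1 * dimS K n.+1 d.+1 = (d.+1 + n) * dimS K n.+1 d)%N.
Proof. by rewrite !dimS_bin addSn -mul_bin_diag. Qed.

(** This is where having at least two variables matters: the dimensions then grow without bound, and
    both error terms of [p_ge] are divided by one of them. *)
Lemma dimS_gtn (K : fieldType) n d : (d < dimS K n.+2 d)%N.
Proof.
by rewrite dimS_bin -binSn addnS -addSn; apply: leq_bin2l; apply: leq_addr.
Qed.

Lemma dimS_homo (K : fieldType) n : {homo dimS K n.+1 : a b / (a <= b)%N}.
Proof.
apply: homo_leq => [//|y x z /leq_trans|d]; first exact.
rewrite -(leq_pmul2l (ltn0Sn d)) dimS_recr leq_mul2r leq_addr orbT //.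
Qed.

(** Each increment [D (j + 1) - D j] equals [n / (j + 1) * D j], which is at most
    [n / (d + 1) * D (d + m)] when [d <= j < d + m]; the [m] increments are summed. *)
Lemma dimS_shift (K : fieldType) n d m :
  (d.+1 * dimS K n.+1 (d + m)
     <= d.+1 * dimS K n.+1 d + m * n * dimS K n.+1 (d + m))%N.
Proof.
elim: m => [|m IHm]; first by rewrite addn0 mul0n addn0.
have mono := dimS_homo K n _ _ (leqnSn (d + m)).
have rec := dimS_recr K n (d + m).
rewrite addnS.
nia.
Qed.

Lemma dimS_shift_le2 (K : fieldType) n d m : (2 * (m * n) <= d.+1)%N ->
  (dimS K n.+1 (d + m) <= 2 * dimS K n.+1 d)%N.
Proof.
move=> hd; have := dimS_shift K n d m.
set a := dimS _ _ _; set b := dimS _ _ _ => h.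
have : (2 * (m * n) * a <= d.+1 * a)%N by rewrite leq_mul2r hd orbT.
rewrite -(leq_pmul2l (ltn0Sn d)); nia.
Qed.

Definition quo (K : fieldType) n d r : nat := (dimS K n (d + r) %/ dimS K n r)%N.

Lemma uncovered_gap (K : fieldType) n d z m :
  (z <= dimS K n.+1 d)%N -> ~ covered K n.+1 d z ->
  (z <= quo K n.+1 d m + dimS K n.+1 m)%N \/
  exists2 r, (r < m)%N &
    (quo K n.+1 d r < z + dimS K n.+1 r)%N
    && (z <= quo K n.+1 d r + dimS K n.+1 r)%N.
Proof.
move=> zD uncov; elim: m => [|m [le_z|[r lt_rm gap_r]]].
- by left; rewrite /quo addn0 dimS_deg0 divn1 addn1 leqW.
- have [lt_z|ge_z] := ltnP (quo K n.+1 d m) (z + dimS K n.+1 m).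
    by right; exists m => //; rewrite lt_z le_z.
  left; rewrite leqNgt; apply/negP => gt_z; apply: uncov; exists m.
  rewrite -addnA addn1; split.
    rewrite -lerBrDr -natrB; last by apply: leq_trans (ltnW gt_z); rewrite leq_addl.
    rewrite ler_pdivrMr ?ltr0n ?dimS_gt0 // -natrM ler_nat.
    apply/ltnW; rewrite -ltn_divLR ?dimS_gt0 //.
    by rewrite ltn_subRL addnC.
  rewrite lerBrDr -natrD ler_pdivlMr ?ltr0n ?dimS_gt0 // -natrM ler_nat.
  by rewrite -leq_divRL ?dimS_gt0.
- by right; exists r => //; apply: ltnW.
Qed.

(** The part of the count of uncovered [z] that does not involve [d]; [quo] is kept apart because it
    grows with [d]. *)
Definition gaps (K : fieldType) n m : nat :=
  (dimS K n m + \sum_(r < m) 2 * dimS K n r)%N.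

Lemma card_covered (K : fieldType) n d m :
  (dimS K n.+1 d <=
    #|[pred z : 'I_(dimS K n.+1 d).+1 | (0 < z)%N && `[< covered K n.+1 d z >]]|
    + (quo K n.+1 d m + gaps K n.+1 m))%N.
Proof.
set C := [pred z | _].
pose U :=
  [pred z : 'I_(dimS K n.+1 d).+1 | (0 < z)%N && ~~ `[< covered K n.+1 d z >]].
(* The pieces of [L] may overlap, since only its size counts. If the subtraction truncates to 0,
   then [2 * D r > q r + D r], so the piece still contains the whole gap. *)
pose L := (iota 1 (quo K n.+1 d m + dimS K n.+1 m) ++
  flatten [seq iota (quo K n.+1 d r + 1 - dimS K n.+1 r) (2 * dimS K n.+1 r)
          | r <- iota 0 m])%N.
have sizeL : size L = (quo K n.+1 d m + gaps K n.+1 m)%N.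
  rewrite size_cat size_iota size_flatten /shape -map_comp /gaps addnA.
  congr addn; rewrite sumnE big_map -[m in iota 0 m]subn0 big_mkord.
  by apply: eq_bigr => r _; rewrite /= size_iota.
have UL : (#|U| <= size L)%N.
  rewrite cardE -(size_map val); apply: uniq_leq_size.
    by rewrite map_inj_uniq ?enum_uniq //; apply: val_inj.
  move=> _ /mapP[z + ->]; rewrite mem_enum inE => /andP[z0 /asboolPn uncov].
  have zD : (z <= dimS K n.+1 d)%N by rewrite -ltnS.
  rewrite mem_cat; case: (uncovered_gap K n d z m zD uncov) => [le_z|[r lt_rm]].
    by rewrite mem_iota z0 add1n ltnS le_z.
  move=> /andP[h1 h2]; apply/orP; right; apply/flatten_mapP; exists r.
    by rewrite mem_iota.
  rewrite mem_iota -[\val z]/(nat_of_ord z); lia.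
rewrite -sizeL; apply: leq_trans (leq_add (leqnn _) UL).
(* The ordinals start at 0, so exactly [D d] of them are positive, and each lies in [C] or in
   [U]. *)
have := cardC1 (ord0 : 'I_(dimS K n.+1 d).+1).
rewrite card_ord -pred_Sn => {1}<-; rewrite -cardUI.
apply: leq_trans (leq_addr _ _); apply: subset_leq_card.
apply/fintype.subsetP => z; rewrite !inE => z0.
have -> : (0 < z)%N by rewrite lt0n.
exact: orbN.
Qed.

Lemma p_le1 (R : realType) (K : fieldType) n d : p R K n.+1 d <= 1.
Proof.
rewrite /p ler_pdivrMr ?ltr0n ?dimS_gt0 // mul1r ler_nat.
set C := [pred z | _].
have : (#|C| <= #|predC1 (ord0 : 'I_(dimS K n.+1 d).+1)|)%N.
  apply: subset_leq_card; apply/fintype.subsetP => z; rewrite !inE => /andP[z0 _].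
  by apply: contraTneq z0 => ->.
by rewrite cardC1 card_ord.
Qed.

Lemma p_ge (R : realType) (K : fieldType) n d m : (2 * (m * n.+1) <= d.+1)%N ->
  1 - (2 / m.+1%:R + (gaps K n.+2 m)%:R / d.+1%:R) <= p R K n.+2 d.
Proof.
move=> hd; have D0 : 0 < (dimS K n.+2 d)%:R :> R by rewrite ltr0n dimS_gt0.
rewrite lerBlDr -(ler_pM2r D0) mul1r mulrDl /p divfK ?gt_eqF //.
have := card_covered K n.+1 d m; rewrite -(ler_nat R) => /le_trans -> //.
rewrite !natrD lerD2l mulrDl lerD //.
  (* The chain is [q m * (m + 1) <= q m * D m <= D (d + m) <= 2 * D d]. *)
  rewrite mulrAC ler_pdivlMr ?ltr0n // -!natrM ler_nat.
  apply: leq_trans (dimS_shift_le2 K _ _ _ hd).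
  by apply: leq_trans (leq_trunc_div _ (dimS K n.+2 m)); rewrite leq_mul2l dimS_gtn orbT.
rewrite mulrAC -mulrA ler_peMr ?ler0n // ler_pdivlMr ?ltr0n // mul1r ler_nat.
exact: dimS_gtn.
Qed.

Theorem proposition3 (R : realType) (K : closedFieldType)
    (charK0 : [pchar K] =i pred0) (n : nat) (n_ge2 : (2 <= n)%N) :
  p R K n d @[d --> \oo] --> (1 : R).
Proof.
case: n n_ge2 => [//|[//|n]] _.
apply/cvgrPdist_le => e e0.
have small (x : R) : 0 <= x -> exists N, forall k, (N <= k)%N -> x / k.+1%:R <= e / 2.
  move=> x0; exists (Num.bound (x / (e / 2))) => k hk.
  rewrite ler_pdivrMr ?ltr0n // mulrC -ler_pdivrMr ?divr_gt0 //.
  apply: ltW; apply: lt_le_trans (archi_boundP _) _.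
    by rewrite divr_ge0 // divr_ge0 // ltW.
  by rewrite ler_nat ltnW.
(* The order matters: [m] depends on [e] alone, and only then is [d0] chosen, since [gaps] depends
   on [m]. *)
have [m hm] := small 2 (ler0n _ _).
have [d0 hd0] := small (gaps K n.+2 m)%:R (ler0n _ _).
near=> d.
rewrite ger0_norm ?subr_ge0 ?p_le1 // lerBlDr addrC -lerBlDr.
apply: le_trans (p_ge R K n d m _); last first.
  by apply: ltnW; near: d; exact: nbhs_infty_ge.
rewrite lerD2l lerN2 [leRHS](splitr e) lerD ?hm // hd0 //.
by near: d; exact: nbhs_infty_ge.
Unshelve. all: by end_near.
Qed.
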